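(* Let $f\colon\mathbb{R}_+\to\mathbb{R}_+$ be an increasing function satisfying the following condition: there exists $C_1>0$ such that for all $k\ge 1$ and all $\rho_1,\ldots,\rho_k\ge 0$, $$\sum_{i\le k} f(\rho_i)\le C_1 f\Big(C_1\sum_{i\le k}\rho_i\Big).$$ Then the class $\mathcal{C}_{\mathrm{CD}}(f)$ is closed under finite graph products: if $I$ is a finite set and $(G_i)_{i\in I}$ is a family of groups in $\mathcal{C}_{\mathrm{CD}}(f)$, then every graph product of $(G_i)_{i\in I}$ belongs to $\mathcal{C}_{\mathrm{CD}}(f)$.
   Context: $\mathbb{R}_+=[0,\infty)$. Growth of actions. Let $G$ be a finitely generated group with a finite symmetric generating set $S$, and let $B_G(n)$ be the ball of radius $n$ around the identity for the word metric of $S$. For a $G$-set $X$ (not assumed transitive), put $\mathrm{vol}_{G,X}(n)=\max_{x\in X}|B_G(n)\cdot x|$. Write $\mathrm{vol}_{G,X}(n)\preccurlyeq f(n)$ if there is $C>0$ such that $\mathrm{vol}_{G,X}(n)\le C f(Cn)$ for all integers $n\ge1$. The Schreier graph $\Gamma(G,X)$ has vertex set $X$ and edges $(x,sx)$, $x\in X$, $s\in S$; $d$ denotes its graph distance. For a $G$-orbit $O$, $\Gamma(G,O)$ is the corresponding connected component. Orbits of controlled diameter. The $G$-action on $X$ has orbits of controlled diameter if all $G$-orbits in $X$ are finite and there is $C>0$ such that for every non-trivial $g\in G$ there exist a $G$-orbit $O$ in $X$ and $x\in O$ with $gx\neq x$ and $\mathrm{diam}(\Gamma(G,O))\le C\,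 d(x,gx)$. This does not depend on the choice of $S$. $\mathcal{C}_{\mathrm{CD}}(f)$ is the class of finitely generated groups $G$ admitting a $G$-set $X$ such that the action has orbits of controlled diameter and $\mathrm{vol}_{G,X}(n)\preccurlyeq f(n)$. Graph product. Let $c$ be a map from the set of pairs $(i,j)\in I^2$ with $i\ne j$ to $\{0,1\}$ such that $c(i,j)=c(j,i)$. The graph product of $(G_i)_{i\in I}$ associated to $c$ is the quotient of the free product of the $G_i$ by the relations $[G_i,G_j]=1$ for all $i\neq j$ with $c(i,j)=1$. *)

(* Defs.v *)
From HB Require Import structures.
From mathcomp Require Import all_boot all_order all_algebra finmap.
From mathcomp Require Import boolp classical_sets functions cardinality reals ereal.

Set Implicit Arguments.
Unset Strict Implicit.
Unset Printing Implicit Defensive.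

Import Order.TTheory GRing.Theory Num.Theory.

Local Open Scope classical_set_scope.
Local Open Scope group_scope.

Definition normal_subgroup (H : groupType) (N : set H) : Prop :=
  [/\ N 1,
      forall x y, N x -> N y -> N (x * y),
      forall x, N x -> N x^-1 &
      forall x y, N x -> N (x ^ y)].

Definition normal_closure (H : groupType) (A : set H) : set H :=
  smallest (@normal_subgroup H) A.

Lemma normal_closureP (H : groupType) (A : set H) :
  normal_subgroup (normal_closure A).
Proof.
split=> [N [[]]//|x y Nx Ny N NA|x Nx N NA|x y Nx N NA].
- by have [[_ + _ _] _] := NA; apply; [exact: Nx|exact: Ny].
- by have [[_ _ + _] _] := NA; apply; exact: Nx.
- by have [[_ _ _ +] _] := NA; apply; exact: Nx.
Qed.

Section GroupQuotient.
Variables (H : groupType) (A : set H).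
Local Notation N := (normal_closure A).

Definition coset_rel (x y : H) : bool := `[< N (x^-1 * y) >].

Lemma coset_rel_refl : reflexive coset_rel.
Proof.
by move=> x; apply/asboolP; rewrite mulVg; have [] := normal_closureP A.
Qed.

Lemma coset_rel_sym : symmetric coset_rel.
Proof.
have [_ _ NV _] := normal_closureP A.
by move=> x y; apply/asboolP/asboolP => /NV; rewrite invgM invgK.
Qed.

Lemma coset_rel_trans : transitive coset_rel.
Proof.
have [_ NM _ _] := normal_closureP A.
move=> y x z /asboolP Nxy /asboolP Nyz; apply/asboolP.
by have := NM _ _ Nxy Nyz; rewrite mulgA mulgK.
Qed.

Canonical coset_equiv :=
  EquivRel coset_rel coset_rel_refl coset_rel_sym coset_rel_trans.

Local Open Scope quotient_scope.

Definition group_quotient := {eq_quot coset_equiv}.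
HB.instance Definition _ := Choice.on group_quotient.
HB.instance Definition _ := EqQuotient.on group_quotient.

Definition gq_mul (x y : group_quotient) : group_quotient :=
  \pi_group_quotient (repr x * repr y).
Definition gq_inv (x : group_quotient) : group_quotient :=
  \pi_group_quotient (repr x)^-1.

Lemma gq_piP (x y : H) :
  \pi_group_quotient x = \pi_group_quotient y <-> N (x^-1 * y).
Proof. by split=> [/eqmodP/asboolP|?] //; apply/eqmodP/asboolP. Qed.

Lemma gq_repr (x : H) : N (x^-1 * repr (\pi_group_quotient x)).
Proof. by apply/gq_piP; rewrite reprK. Qed.

Lemma gq_piM (x y : H) : gq_mul (\pi x) (\pi y) = \pi_group_quotient (x * y).
Proof.
have [_ NM _ NJ] := normal_closureP A.
apply/esym/gq_piP; rewrite invgM -mulgA (mulgA x^-1).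
have := NM _ _ (NJ _ y (gq_repr x)) (gq_repr y).
by rewrite /conjg !mulgA mulgK.
Qed.

Lemma gq_piV (x : H) : gq_inv (\pi x) = \pi_group_quotient x^-1.
Proof.
have [_ _ _ NJ] := normal_closureP A.
apply/gq_piP; rewrite invgK.
by have := NJ _ x^-1 (gq_repr x); rewrite /conjg invgK mulgA mulVKg.
Qed.

Lemma gq_mulA : associative gq_mul.
Proof.
by elim/quotW=> x; elim/quotW=> y; elim/quotW=> z; rewrite !gq_piM mulgA.
Qed.

Lemma gq_mul1 : left_id (\pi_group_quotient 1) gq_mul.
Proof. by elim/quotW=> x; rewrite gq_piM mul1g. Qed.

Lemma gq_mulr1 : right_id (\pi_group_quotient 1) gq_mul.
Proof. by elim/quotW=> x; rewrite gq_piM mulg1. Qed.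

Lemma gq_mulV : left_inverse (\pi_group_quotient 1) gq_inv gq_mul.
Proof. by elim/quotW=> x; rewrite gq_piV gq_piM mulVg. Qed.

Lemma gq_mulrV : right_inverse (\pi_group_quotient 1) gq_inv gq_mul.
Proof. by elim/quotW=> x; rewrite gq_piV gq_piM mulgV. Qed.

HB.instance Definition _ := isGroup.Build group_quotient
  gq_mulA gq_mul1 gq_mulr1 gq_mulV gq_mulrV.

End GroupQuotient.

Section FreeProduct.
Variables (I : choiceType) (G : I -> groupType).

Definition fp_word := seq {i : I & G i}.

(** The least monoid congruence on words identifying [(i, 1)] with the empty
    word and [(i, a)(i, b)] with [(i, ab)]. *)
Inductive fp_cong : fp_word -> fp_word -> Prop :=
| fp_cong_refl u : fp_cong u u
| fp_cong_sym u v : fp_cong u v -> fp_cong v u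
| fp_cong_trans u v w : fp_cong u v -> fp_cong v w -> fp_cong u w
| fp_cong_cat u u' v v' :
    fp_cong u u' -> fp_cong v v' -> fp_cong (u ++ v) (u' ++ v')
| fp_cong_one i : fp_cong [:: Tagged G (1 : G i)] [::]
| fp_cong_mul i (a b : G i) :
    fp_cong [:: Tagged G a; Tagged G b] [:: Tagged G (a * b)].

Definition fp_rel (u v : fp_word) : bool := `[< fp_cong u v >].

Lemma fp_rel_refl : reflexive fp_rel.
Proof. by move=> u; apply/asboolP; exact: fp_cong_refl. Qed.

Lemma fp_rel_sym : symmetric fp_rel.
Proof. by move=> u v; apply/asboolP/asboolP; exact: fp_cong_sym. Qed.

Lemma fp_rel_trans : transitive fp_rel.
Proof.
move=> v u w /asboolP uv /asboolP vw; apply/asboolP.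
exact: fp_cong_trans uv vw.
Qed.

Canonical fp_equiv := EquivRel fp_rel fp_rel_refl fp_rel_sym fp_rel_trans.

Local Open Scope quotient_scope.

Definition free_product := {eq_quot fp_equiv}.
HB.instance Definition _ := Choice.on free_product.
HB.instance Definition _ := EqQuotient.on free_product.

Definition fp_word_inv (u : fp_word) : fp_word :=
  rev [seq Tagged G (tagged x : G (tag x))^-1 | x <- u].

Definition fp_mul (x y : free_product) : free_product :=
  \pi_free_product (repr x ++ repr y).
Definition fp_inv (x : free_product) : free_product :=
  \pi_free_product (fp_word_inv (repr x)).

Lemma fp_piP (u v : fp_word) :
  \pi_free_product u = \pi_free_product v <-> fp_cong u v.
Proof. by split=> [/eqmodP/asboolP|?] //; apply/eqmodP/asboolP. Qed.

Lemma fp_repr (u : fp_word) : fp_cong (repr (\pi_free_product u)) u.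
Proof. by apply/fp_piP; rewrite reprK. Qed.

Lemma fp_piM (u v : fp_word) :
  fp_mul (\pi u) (\pi v) = \pi_free_product (u ++ v).
Proof. by apply/fp_piP/fp_cong_cat; exact: fp_repr. Qed.

Lemma fp_word_inv_cat (u v : fp_word) :
  fp_word_inv (u ++ v) = fp_word_inv v ++ fp_word_inv u.
Proof. by rewrite /fp_word_inv map_cat rev_cat. Qed.

Lemma fp_cong_inv (u v : fp_word) :
  fp_cong u v -> fp_cong (fp_word_inv u) (fp_word_inv v).
Proof.
elim=> {u v} [u|u v _|u v w _ uv _ vw|u u' v v' _ uu' _ vv'|i|i a b].
- exact: fp_cong_refl.
- exact: fp_cong_sym.
- exact: fp_cong_trans uv vw.
- by rewrite !fp_word_inv_cat; exact: fp_cong_cat.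
- by rewrite /fp_word_inv /= invg1; exact: fp_cong_one.
- by rewrite /fp_word_inv /= invgM; exact: fp_cong_mul.
Qed.

Lemma fp_piV (u : fp_word) :
  fp_inv (\pi u) = \pi_free_product (fp_word_inv u).
Proof. by apply/fp_piP/fp_cong_inv; exact: fp_repr. Qed.

Lemma fp_word_invK : involutive fp_word_inv.
Proof.
move=> u; rewrite /fp_word_inv map_rev revK -map_comp.
by rewrite -[RHS]map_id; apply: eq_map => -[i a] /=; rewrite invgK.
Qed.

Lemma fp_word_mulV (u : fp_word) : fp_cong (u ++ fp_word_inv u) [::].
Proof.
elim: u => [|[i a] u IHu]; first exact: fp_cong_refl.
rewrite -cat1s fp_word_inv_cat -catA (catA u).
apply: (@fp_cong_trans _ ([:: Tagged G a] ++ ([::] ++ [:: Tagged G a^-1]))).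
  apply: fp_cong_cat; first exact: fp_cong_refl.
  by apply: fp_cong_cat => //; exact: fp_cong_refl.
apply: fp_cong_trans (fp_cong_mul a a^-1) _.
by rewrite mulgV; exact: fp_cong_one.
Qed.

Lemma fp_mulA : associative fp_mul.
Proof.
by elim/quotW=> x; elim/quotW=> y; elim/quotW=> z; rewrite !fp_piM catA.
Qed.

Lemma fp_mul1 : left_id (\pi_free_product [::]) fp_mul.
Proof. by elim/quotW=> x; rewrite fp_piM. Qed.

Lemma fp_mulr1 : right_id (\pi_free_product [::]) fp_mul.
Proof. by elim/quotW=> x; rewrite fp_piM cats0. Qed.

Lemma fp_mulrV : right_inverse (\pi_free_product [::]) fp_inv fp_mul.
Proof.
by elim/quotW=> x; rewrite fp_piV fp_piM; apply/fp_piP/fp_word_mulV.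
Qed.

Lemma fp_mulV : left_inverse (\pi_free_product [::]) fp_inv fp_mul.
Proof.
elim/quotW=> x; rewrite fp_piV fp_piM; apply/fp_piP.
by rewrite -{2}(fp_word_invK x); exact: fp_word_mulV.
Qed.

HB.instance Definition _ := isGroup.Build free_product
  fp_mulA fp_mul1 fp_mulr1 fp_mulV fp_mulrV.

Definition fp_in (i : I) (a : G i) : free_product :=
  \pi_free_product [:: Tagged G a].

End FreeProduct.

Definition graph_relators (I : choiceType) (G : I -> groupType)
    (c : I -> I -> bool) : set (free_product G) :=
  [set r | exists (i j : I) (a : G i) (b : G j),
     [/\ i != j, c i j & r = [~ fp_in a, fp_in b]]].

Definition graph_product (I : choiceType) (G : I -> groupType)
    (c : I -> I -> bool) : groupType :=
  group_quotient (graph_relators (G := G) c).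

Definition word_ball (G : groupType) (S : set G) (n : nat) : set G :=
  [set g | exists w : seq G,
     [/\ (size w <= n)%N, {in w, forall s, S s} & g = \prod_(s <- w) s]].

Definition symmetric_generating (G : groupType) (S : set G) : Prop :=
  (forall s, S s -> S s^-1) /\ (forall g, exists n, word_ball S n g).

Record group_action (G : groupType) (X : Type) := GroupAction {
  act :> G -> X -> X;
  act1 : forall x, act 1 x = x;
  actM : forall g h x, act (g * h) x = act g (act h x) }.

Section Growth.
Variables (R : realType) (G : groupType) (S : set G).
Variables (X : choiceType) (a : group_action G X).

Definition act_orbit (x : X) : set X := [set a g x | g in [set: G]].

(** The sets [B_G(n) x] are finite as soon as [S] is, so [fset_set] gives their
    actual cardinality; and the supremum is then a maximum unless [X] is empty. *)
Definition vol (n : nat) : \bar R :=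
  ereal_sup [set (#|` fset_set [set a g x | g in word_ball S n]|%:R)%:E
            | x in [set: X]].

Definition vol_preceq (f : R -> R) : Prop :=
  exists2 C : R, (0 < C)%R &
    forall n : nat, (1 <= n)%N -> (vol n <= (C * f (C * n%:R))%:E)%E.

Definition schreier_edge (x y : X) : bool := `[< exists2 s, S s & y = a s x >].

(** Graph distance: [+oo] between different connected components. *)
Definition schreier_dist (x y : X) : \bar R :=
  ereal_inf [set ((size p)%:R)%:E
            | p in [set p : seq X | path schreier_edge x p /\ last x p = y]].

Definition diam (A : set X) : \bar R :=
  ereal_sup [set schreier_dist x y | x in A & y in A].

Definition orbits_of_controlled_diameter : Prop :=
  (forall x, finite_set (act_orbit x)) /\
  exists2 C : R, (0 < C)%R &
    forall g : G, g <> 1 -> exists (O : set X) (x : X),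
      [/\ exists x0, O = act_orbit x0, O x, a g x <> x &
          (diam O <= C%:E * schreier_dist x (a g x))%E].

End Growth.

(** The choice of [S] is immaterial, as is the restriction of [X] to a
    [choiceType]: classically, every type carries such a structure. *)
Definition class_CD (R : realType) (f : R -> R) (G : groupType) : Prop :=
  exists S : set G, [/\ finite_set S, symmetric_generating S &
    exists (X : choiceType) (a : group_action G X),
      orbits_of_controlled_diameter R S a /\ vol_preceq S a f].

(* Main.v *)
From HB Require Import structures.
Require Import Defs.
From mathcomp Require Import all_boot all_order all_algebra finmap.
From mathcomp Require Import boolp classical_sets functions cardinality reals ereal.
From mathcomp Require Import zify ring lra.

Set Implicit Arguments.
Unset Strict Implicit.
Unset Printing Implicit Defensive.

Import Order.TTheory GRing.Theory Num.Theory.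

Local Open Scope classical_set_scope.
Local Open Scope group_scope.
Local Open Scope nat_scope.

(** Each [G i] acts on some [X i] with controlled orbits, and a graph product
    has to be given one action that does the same job.  Writing [U] for the
    disjoint union of the [X i], finite orbits in [U] are glued in a row: a
    chain is a list of links [(x_j, y_j)], where [y_j] lies in the orbit [O_j] of
    [x_j] under the vertex group [G (i_j)] and the distance [D_j] from [x_j] to
    [y_j] is positive and comparable to the diameter of [O_j]; the point [y_j]
    is identified with [x_(j+1)].  Every vertex group acts on the tiles [O_j] of
    its own index and fixes everything else.  If consecutive indices are
    distinct and do not commute in the graph product, two commuting vertex
    groups have disjoint supports on the glued space, so that the graph product
    acts on it ([glued_comm], [graph_product_action]).

    Non-trivial elements are moved far.  Take a shortest word for [g], read it
    from the syllable that acts first, and keep that syllable; after a kept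
    syllable, keep the next one that does not commute with it.  Since the word
    cannot be shortened, this next syllable has a different index
    ([reduced_next]).  Each kept syllable [h] provides a link from some [x] to
    [h x], and on the resulting chain the kept syllables push the first point
    all the way to the last one, whereas the skipped syllables fix the gluing
    point at which they act ([greedy_chain]).  The length of the chain is the
    sum of the [D_j]; it bounds the displacement from below, by a 1-Lipschitz
    height function, and the diameter from above up to a constant
    ([glued_controlled]).

    Balls stay small.  A ball of radius [m] consists of a ball in the tile of
    its center, of full tiles [O_j] lying inside a window of width [2 m] of
    heights, and of parts of at most two tiles that straddle the ends of the
    window.  The full tiles have at most a constant times [f (C D_j)] points,
    with the sum of the [D_j] at most [2 m], so the assumption on
    sums of values of [f] bounds their total ([ball_cover]).

    The action that works is the union, over all chains, of the glued spaces. *)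

(** * Word distance in an action *)

Section Reach.
Variables (G : groupType) (S : set G) (X : Type) (a : group_action G X).

(** Words, instead of group elements, make inductions on the length direct. *)
Definition reach (n : nat) (x y : X) : Prop :=
  exists2 w : seq G, size w <= n /\ {in w, forall s, S s} & y = foldr a x w.

Lemma act_prod (w : seq G) x : a (\prod_(s <- w) s)%g x = foldr a x w.
Proof.
by elim: w => [|s w IHw] /=; rewrite ?big_nil ?act1// big_cons actM IHw.
Qed.

Lemma reach_ball n x y :
  reach n x y <-> exists2 g, word_ball S n g & y = a g x.
Proof.
split=> [[w [wn wS] ->]|[g [w [wn wS ->]] ->]].
  by exists (\prod_(s <- w) s)%g; rewrite ?act_prod//; exists w.
by exists w; rewrite ?act_prod.
Qed.

Lemma reach_refl n x : reach n x x.
Proof. by exists [::]. Qed.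

Lemma reach_mono m n x y : m <= n -> reach m x y -> reach n x y.
Proof. by move=> mn [w [wm wS] ->]; exists w => //; split=> //; lia. Qed.

Lemma reach_trans m n x y z : reach m x y -> reach n y z -> reach (n + m) x z.
Proof.
move=> [w [wm wS] ->] [v [vn vS] ->]; exists (v ++ w); last by rewrite foldr_cat.
split; first by rewrite size_cat; lia.
by move=> s; rewrite mem_cat => /orP[/vS|/wS].
Qed.

Lemma reach_step n s x y : S s -> reach n x y -> reach n.+1 x (a s y).
Proof.
move=> Ss [w [wn wS] ->]; exists (s :: w) => //; split=> //.
by move=> t; rewrite inE => /orP[/eqP->//|/wS].
Qed.

Lemma reach0 x y : reach 0 x y -> y = x.
Proof. by move=> [[|s w] [wn _] ->]. Qed.

Lemma act_inv g x : a g^-1%g (a g x) = x.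
Proof. by rewrite -actM mulVg act1. Qed.

Lemma reach_sym n x y : (forall s, S s -> S s^-1%g) -> reach n x y -> reach n y x.
Proof.
move=> SV [w [wn wS] ->]; apply: (reach_mono wn) => {wn}.
elim: w wS => [|s w IHw] wS /=; first exact: reach_refl.
rewrite -addn1; apply: (reach_trans (y := foldr a x w)).
  rewrite -[X in reach _ _ X](act_inv s); apply: reach_step (reach_refl _ _).
  by apply/SV/wS; rewrite mem_head.
by apply: IHw => t tw; apply: wS; rewrite inE tw orbT.
Qed.

Lemma reach_act g x : symmetric_generating S -> exists n, reach n x (a g x).
Proof. by move=> [_ /(_ g)[n gn]]; exists n; apply/reach_ball; exists g. Qed.

End Reach.

Section NatMetric.
Variables (R : realType) (f : R -> R).

(** The conditions defining the class, with distances measured by natural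
    numbers, the constant of controlled diameter rounded up to [K], and
    cardinals bounded by the size of a covering list, so that neither suprema
    nor finiteness proofs occur in the main argument. *)
Record CD_data (G : groupType) (S : set G) (X : choiceType)
    (a : group_action G X) (K : nat) (C : R) : Prop := CDData {
  cd_fin : finite_set S;
  cd_gen : symmetric_generating S;
  cd_orbit : forall x, exists s : seq X, forall g, a g x \in s;
  cd_diam : forall g, g <> 1%g -> exists2 x, a g x <> x &
    forall n, reach S a n x (a g x) ->
    forall g1 g2, reach S a (K * n) (a g1 x) (a g2 x);
  cd_vol : forall n x, 0 < n -> exists2 s : seq X,
    ((size s)%:R <= C * f (C * n%:R))%R &
    forall y, reach S a n x y -> y \in s }.

Section Translation.
Variables (G : groupType) (S : set G) (X : choiceType) (a : group_action G X).

Lemma reach_path n x y : reach S a n x y <->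
  exists p, [/\ size p <= n, path (schreier_edge S a) x p & last x p = y].
Proof.
split=> [[w [wn wS] ->]|[p [pn]]].
  suff [p [sp px lp]] : exists p,
     [/\ size p = size w, path (schreier_edge S a) x p & last x p = foldr a x w].
    by exists p; rewrite sp.
  elim: w wS {wn} => [|s w IHw] wS; first by exists [::].
  have [|p [sp px lp]] := IHw; first by move=> t tw; apply: wS; rewrite inE tw orbT.
  exists (rcons p (a s (foldr a x w))); split; rewrite ?size_rcons ?sp ?last_rcons//.
  rewrite rcons_path px lp/=; apply/asboolP; exists s => //.
  by apply: wS; rewrite mem_head.
elim: p x n pn => [|z p IHp] x n /= pn; first by move=> _ <-; exact: reach_refl.
move=> /andP[/asboolP[s Ss zE] pz lp].
case: n pn => // n pn; rewrite -addn1.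
apply: reach_trans (IHp _ _ pn pz lp); rewrite zE.
exact: reach_step (reach_refl _ _ _ _).
Qed.

Lemma schreier_dist_le n x y : reach S a n x y ->
  (schreier_dist R S a x y <= n%:R%:E)%E.
Proof.
move=> /reach_path[p [pn px lp]]; apply: (@le_trans _ _ ((size p)%:R)%:E).
  by apply: ereal_inf_lbound; exists p.
by rewrite lee_fin ler_nat.
Qed.

Lemma le_schreier_dist n x y : (forall m, reach S a m x y -> n <= m) ->
  (n%:R%:E <= schreier_dist R S a x y)%E.
Proof.
move=> nP; apply: le_ereal_inf_tmp => _ [p [px lp] <-].
by rewrite lee_fin ler_nat; apply: nP; apply/reach_path; exists p.
Qed.

Lemma schreier_dist_lt n x y : (schreier_dist R S a x y < n.+1%:R%:E)%E ->
  reach S a n x y.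
Proof.
move=> /ereal_inf_lt[_ [p [px lp] <-]]; rewrite lte_fin ltr_nat => pn.
by apply/reach_path; exists p.
Qed.

End Translation.

Lemma class_CD_data (G : groupType) : class_CD f G ->
  exists (S : set G) (X : choiceType) (a : group_action G X) (K : nat) (C : R),
    (0 < C)%R /\ CD_data S a K C.
Proof.
move=> [S [Sfin Sgen [X [a [[ofin [D D0 oD]] [C C0 vC]]]]]].
have orb x : exists s : seq X, forall g, a g x \in s.
  exists (fset_set (act_orbit a x)) => g.
  by rewrite in_fset_set// inE; exists g.
exists S, X, a, (Num.bound D), C; split=> //; split=> //.
  move=> g /oD[O [x [[x0 ->] [g0 _ g0x] gx dO]]]; exists x => // n nx g1 g2.
  apply: schreier_dist_lt; have [n0|n0] := posnP n.
    by case: gx; rewrite n0 in nx; exact: reach0 nx.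
  apply: (@le_lt_trans _ _ (diam R S a (act_orbit a x0))).
    apply: ereal_sup_ubound; exists (a g1 x).
      by exists (g1 * g0)%g => //; rewrite actM g0x.
    by exists (a g2 x) => //; exists (g2 * g0)%g => //; rewrite actM g0x.
  apply: le_lt_trans dO _.
  apply: (@le_lt_trans _ _ (D%:E * n%:R%:E)%E).
    by rewrite lee_pmul2l//; exact: schreier_dist_le.
  rewrite -EFinM lte_fin -addn1 natrD natrM ltr_pwDr//.
  by apply: ler_wpM2r => //; apply/ltW/archi_boundP/ltW.
move=> n x n0; have fB : finite_set [set a g x | g in word_ball S n].
  by apply: sub_finite_set (ofin x) => _ [g _ <-]; exists g.
exists (fset_set [set a g x | g in word_ball S n]).
  rewrite -lee_fin; apply: le_trans (vC n n0).
  by apply: ereal_sup_ubound; exists x.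
by move=> y /reach_ball[g gn ->]; rewrite in_fset_set// inE; exists g.
Qed.

Lemma CD_data_class (G : groupType) (S : set G) (X : choiceType)
    (a : group_action G X) (K : nat) (C : R) :
  (0 < C)%R -> CD_data S a K C -> class_CD f G.
Proof.
move=> C0 [Sfin Sgen orb dia volu]; exists S; split=> //; exists X, a; split.
  split=> [x|].
    have [s sP] := orb x.
    by apply: (sub_finite_set _ (finite_seq s)) => _ [g _ <-] /=; exact: sP.
  exists (K.+1%:R)%R; first by rewrite ltr0n.
  move=> g /dia[x gx xP]; exists (act_orbit a x), x; split=> //.
  - by exists x.
  - by exists 1%g => //; rewrite act1.
  have ex : exists n, `[< reach S a n x (a g x) >].
    by have [n nP] := reach_act a g x Sgen; exists n; apply/asboolP.
  case: (ex_minnP ex) => n /asboolP nP nmin.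
  apply: (@le_trans _ _ ((K.+1%:R)%R%:E * (n%:R)%R%:E)%E).
    apply: ge_ereal_sup => _ [_ [g1 _ <-] [_ [g2 _ <-] <-]].
    rewrite -EFinM -natrM; apply: schreier_dist_le.
    by apply: reach_mono (xP n nP g1 g2); rewrite leq_mul2r leqnSn orbT.
  rewrite lee_pmul2l ?lte_fin ?ltr0n//; apply: le_schreier_dist => m mP.
  by apply: nmin; apply/asboolP.
exists C => // n n0; apply: ge_ereal_sup => _ [x _ <-].
have [s sC sP] := volu n x n0; rewrite lee_fin; apply: le_trans sC; rewrite ler_nat.
apply: uniq_leq_size; first exact: fset_uniq.
have fB : finite_set [set a g x | g in word_ball S n].
  apply: (sub_finite_set _ (finite_seq s)) => _ [g gn <-] /=.
  by apply: sP; apply/reach_ball; exists g.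
move=> y; rewrite in_fset_set// inE => -[g gn <-].
by apply: sP; apply/reach_ball; exists g.
Qed.

End NatMetric.

(** * Actions of graph products *)

Section QuotientAction.
Variables (H : groupType) (A : set H) (Z : Type) (a : group_action H Z).
Hypothesis aA : forall r, A r -> forall z, a r z = z.

(** The kernel of an action is normal. *)
Lemma normal_closure_act_trivial r :
  normal_closure A r -> forall z, a r z = z.
Proof.
suff nK : normal_subgroup [set x | forall z, a x z = z].
  by move=> Nr z; apply: (Nr [set x | forall z, a x z = z]).
have aV x : (forall z, a x z = z) -> forall z, a x^-1%g z = z.
  by move=> xK z; rewrite -[in LHS](xK z) act_inv.
split=> [z|x y xK yK z|x|x y xK z] /=; first exact: act1.
- by rewrite actM yK xK.
- exact: aV.
- by rewrite conjgE !actM xK act_inv.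
Qed.

Lemma pi_eq_act (x y : H) :
  \pi_(group_quotient A)%qT x = \pi_(group_quotient A)%qT y ->
  forall z, a x z = a y z.
Proof.
move=> /gq_piP/normal_closure_act_trivial xy z.
by rewrite -{1}(xy z) -actM mulgA mulgV mul1g.
Qed.

Lemma quotient_action : exists b : group_action (group_quotient A) Z,
  forall x z, b (\pi_(group_quotient A)%qT x) z = a x z.
Proof.
pose b (g : group_quotient A) z := a (repr g) z.
have bE x z : b (\pi_(group_quotient A)%qT x) z = a x z.
  by apply: pi_eq_act; rewrite reprK.
have b1 z : b 1%g z = z by rewrite bE act1.
have bM (g h : group_quotient A) z : b (g * h)%g z = b g (b h z).
  by rewrite [LHS](bE (repr g * repr h)%g) actM.
by exists (GroupAction b1 bM).
Qed.

End QuotientAction.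

Section FreeProductAction.
Variables (I : choiceType) (G : I -> groupType) (Z : Type).
Variable a : forall i, group_action (G i) Z.

Definition word_act (u : fp_word G) (z : Z) : Z :=
  foldr (fun t => a (tag t) (tagged t)) z u.

Lemma word_act_cat u v z : word_act (u ++ v) z = word_act u (word_act v z).
Proof. by rewrite /word_act foldr_cat. Qed.

Lemma word_act_cong u v : fp_cong u v -> forall z, word_act u z = word_act v z.
Proof.
elim=> {u v} [//|u v _ uv z|u v w _ uv _ vw z|u u' v v' _ uu _ vv z|i z|i g h z] //=.
- by rewrite uv vw.
- by rewrite !word_act_cat vv uu.
- exact: act1.
- by rewrite actM.
Qed.

Lemma free_product_action : exists b : group_action (free_product G) Z,
  forall i (g : G i) z, b (fp_in g) z = a i g z.
Proof.
pose b (g : free_product G) z := word_act (repr g) z.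
have bE u z : b (\pi_(free_product G)%qT u) z = word_act u z.
  by apply: word_act_cong; exact: fp_repr.
have b1 z : b 1%g z = z by rewrite [LHS](bE [::]).
have bM (g h : free_product G) z : b (g * h)%g z = b g (b h z).
  by rewrite [LHS](bE (repr g ++ repr h)) word_act_cat.
by exists (GroupAction b1 bM) => i g z; rewrite [LHS](bE [:: Tagged G g]).
Qed.

End FreeProductAction.

Section GraphProduct.
Variables (I : choiceType) (G : I -> groupType) (c : I -> I -> bool).

Definition gp_in (i : I) (g : G i) : graph_product G c :=
  \pi_(group_quotient (graph_relators (G := G) c))%qT (fp_in g).

Lemma fp_in1 i : fp_in (1%g : G i) = 1%g.
Proof. by apply/fp_piP; exact: fp_cong_one. Qed.

Lemma fp_inM i (g h : G i) : fp_in (g * h)%g = (fp_in g * fp_in h)%g.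
Proof.
rewrite [RHS](fp_piM [:: Tagged G g] [:: Tagged G h]).
by apply/esym/fp_piP; exact: fp_cong_mul.
Qed.

Lemma pi_group_quotientM (H : groupType) (A : set H) (x y : H) :
  \pi_(group_quotient A)%qT (x * y)%g =
  (\pi_(group_quotient A)%qT x * \pi_(group_quotient A)%qT y)%g.
Proof. exact/esym/gq_piM. Qed.

Lemma gp_in1 i : gp_in (1%g : G i) = 1%g.
Proof. by rewrite /gp_in fp_in1. Qed.

Lemma gp_inM i (g h : G i) : gp_in (g * h)%g = (gp_in g * gp_in h)%g.
Proof. by rewrite /gp_in fp_inM pi_group_quotientM. Qed.

Lemma gp_inV i (g : G i) : gp_in g^-1%g = (gp_in g)^-1%g.
Proof. by apply/eqP; rewrite -mulg_eq1 -gp_inM mulVg gp_in1. Qed.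

Lemma gp_in_comm i j (g : G i) (h : G j) : i != j -> c i j ->
  (gp_in g * gp_in h)%g = (gp_in h * gp_in g)%g.
Proof.
move=> ij cij; rewrite -!pi_group_quotientM; apply/esym/gq_piP => N [_]; apply.
exists i, j, g, h; split=> //.
by rewrite invgM /commg /conjg !mulgA.
Qed.

(** The universal property of the graph product, for maps into the
    permutations of [Z]. *)
Lemma graph_product_action (Z : Type) (a : forall i, group_action (G i) Z) :
  (forall i j (g : G i) (h : G j) z, i != j -> c i j ->
     a i g (a j h z) = a j h (a i g z)) ->
  exists b : group_action (graph_product G c) Z,
    forall i (g : G i) z, b (gp_in g) z = a i g z.
Proof.
move=> comm; have [b bE] := free_product_action a.
have [|d dE] := @quotient_action _ (graph_relators c) _ b; last first.
  by exists d => i g z; rewrite -bE -dE.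
move=> _ [i [j [g [h [ij cij ->]]]]] z.
rewrite /commg /conjg !actM !bE comm//.
have aVE k (x : G k) y : b (fp_in x)^-1%g (a k x y) = y.
  by rewrite -bE act_inv.
by rewrite !aVE.
Qed.

Definition syllables_prod (l : fp_word G) : graph_product G c :=
  foldr (fun t g => (gp_in (tagged t) * g)%g) 1%g l.

Lemma syllables_prod_cat u v :
  syllables_prod (u ++ v) = (syllables_prod u * syllables_prod v)%g.
Proof.
by elim: u => [|t u IHu] /=; rewrite ?mul1g// -mulgA; congr (_ * _)%g.
Qed.

Lemma syllables_prodP (g : graph_product G c) : exists l, syllables_prod l = g.
Proof.
elim/quotW: g => x; elim/quotW: x => l; exists l; elim: l => [//|[i g] l IHl] /=.
rewrite IHl; apply/esym.
rewrite -[RHS]pi_group_quotientM; congr (\pi_(group_quotient _)%qT _).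
exact/esym/(fp_piM [:: Tagged G g] l).
Qed.

End GraphProduct.

(** * Reduced words *)

Section ReducedWords.
Variables (I : choiceType) (G : I -> groupType) (c : I -> I -> bool).

Definition commuting (i j : I) : bool := (i != j) && c i j.

(** The excluded patterns are those that allow a word to be shortened, by deleting
    a syllable or by merging two syllables brought together by commutations.
    They are invariant under reversal, which lets words be read from the syllable
    that acts first. *)
Definition reduced (l : fp_word G) : Prop :=
  (forall l1 t l2, l = l1 ++ t :: l2 -> tagged t <> 1%g) /\
  (forall l1 t l2 t' l3, l = l1 ++ t :: l2 ++ t' :: l3 -> tag t = tag t' ->
     ~~ all (fun s => commuting (tag t) (tag s)) l2).

Lemma syllables_prod_comm (t : {i & G i}) (v : fp_word G) :
  all (fun s => commuting (tag t) (tag s)) v ->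
  (gp_in c (tagged t) * syllables_prod c v =
   syllables_prod c v * gp_in c (tagged t))%g.
Proof.
elim: v => [|s v IHv] /=; first by rewrite mulg1 mul1g.
by move=> /andP[/andP[ts cts] /IHv E]; rewrite mulgA gp_in_comm// -!mulgA E.
Qed.

(** A shortest word is reduced: the forbidden patterns shorten by one syllable. *)
Lemma reduced_word (g : graph_product G c) :
  exists2 l, reduced l & syllables_prod c (rev l) = g.
Proof.
have ex : exists n, `[< exists2 u, syllables_prod c u = g & size u = n >].
  by have [u ug] := syllables_prodP g; exists (size u); apply/asboolP; exists u.
case: (ex_minnP ex) => _ /asboolP[u ug <-] umin.
have {}umin v : syllables_prod c v = g -> size u <= size v.
  by move=> vg; apply: umin; apply/asboolP; exists v.
exists (rev u); last by rewrite revK.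
split=> [l1 [i h] l2 /(congr1 rev)|l1 [i h] l2 [j k] l3 /(congr1 rev)]; rewrite revK.
  rewrite rev_cat rev_cons cat_rcons /= => uE h1.
  have := umin (rev l2 ++ rev l1); rewrite -ug uE !syllables_prod_cat/= h1 gp_in1 mul1g.
  by move=> /(_ erefl); rewrite !size_cat/=; lia.
rewrite rev_cat rev_cons rev_cat rev_cons !cat_rcons -!catA /= => uE ij.
case: _ / ij k uE => k uE; apply/negP => l2c.
have := umin (rev l3 ++ Tagged G (k * h)%g :: rev l2 ++ rev l1).
rewrite -ug uE !syllables_prod_cat/= !syllables_prod_cat/= gp_inM.
have := @syllables_prod_comm (Tagged G h) (rev l2); rewrite all_rev => /(_ l2c)/= E.
rewrite -!mulgA (mulgA (gp_in c h) (syllables_prod c (rev l2))) E -!mulgA.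
by move=> /(_ erefl); rewrite !size_cat/= !size_cat/=; lia.
Qed.

Lemma reduced_behead l1 l2 : reduced (l1 ++ l2) -> reduced l2.
Proof.
move=> [r1 r2]; split=> [v1 t v2 lE|v1 t v2 t' v3 lE].
  by apply: (r1 (l1 ++ v1) t v2); rewrite lE catA.
by apply: (r2 (l1 ++ v1) t v2 t' v3); rewrite lE catA.
Qed.

(** The first syllable that does not commute with the current one is the next to be
    kept.  Were it in the same vertex group, the two would be separated by commuting
    syllables only. *)
Lemma reduced_next t l : reduced (t :: l) ->
  all (fun s => commuting (tag t) (tag s)) l \/
  exists l1 t' l2, [/\ l = l1 ++ t' :: l2,
    all (fun s => commuting (tag t) (tag s)) l1,
    tag t != tag t' & ~~ commuting (tag t) (tag t')].
Proof.
move=> [_ r2]; set P := fun s => commuting (tag t) (tag s).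
have [lP|lP] := boolP (all P l); [by left|right].
have hP : has (predC P) l by rewrite has_predC.
pose k := find (predC P) l; have kl : k < size l by rewrite -has_find.
have lE : l = take k l ++ nth t l k :: drop k.+1 l by rewrite -drop_nth// cat_take_drop.
have l1P : all P (take k l).
  apply/(all_nthP t) => m; rewrite size_take kl => mk; rewrite nth_take//.
  exact: negbFE (before_find t mk).
exists (take k l), (nth t l k), (drop k.+1 l); split=> //.
  apply/negP => /eqP tt.
  by have := r2 [::] t _ _ _ (congr1 (cons t) lE) tt; rewrite l1P.
exact: (nth_find t hP).
Qed.

End ReducedWords.

(** * Chains of tiles and the glued action *)

Definition gp_gens (I : choiceType) (G : I -> groupType) (c : I -> I -> bool)
    (S : forall i, set (G i)) : set (graph_product G c) :=
  [set t | exists i (s : G i), S i s /\ t = gp_in c s].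

Section Chains.
Variables (I : choiceType) (G : I -> groupType) (c : I -> I -> bool).
Hypothesis c_sym : forall i j, i != j -> c i j = c j i.
Variables (U : choiceType) (tg : U -> I) (aU : forall i, group_action (G i) U).
Hypothesis aU_fix : forall i g p, tg p != i -> aU i g p = p.
Hypothesis aU_tg : forall i g p, tg (aU i g p) = tg p.
Variable S : forall i, set (G i).
Arguments S : clear implicits.
Hypothesis S_gen : forall i, symmetric_generating (S i).
Variable K : nat.

(** A point [p] of [U] belongs to the vertex group [G (tg p)]: the others fix it,
    so that distances and orbits in [U] are those of [G (tg p)]. *)
Definition tile_reach n (p q : U) := reach (S (tg p)) (aU (tg p)) n p q.
Definition tile_orbit (p q : U) := exists g, q = aU (tg p) g p.

Lemma tile_reach_tg n p q : tile_reach n p q -> tg q = tg p.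
Proof. by move=> /reach_ball[g _ ->]. Qed.

Lemma tile_reach_refl n p : tile_reach n p p.
Proof. exact: reach_refl. Qed.

Lemma tile_reach_mono m n p q : m <= n -> tile_reach m p q -> tile_reach n p q.
Proof. exact: reach_mono. Qed.

Lemma tile_reach_step n i (s : G i) p q : tg p = i -> S i s ->
  tile_reach n p q -> tile_reach n.+1 p (aU i s q).
Proof. by move=> pi; case: _ / pi s => s; exact: reach_step. Qed.

Lemma tile_reach_orbit n p q : tile_reach n p q -> tile_orbit p q.
Proof. by move=> /reach_ball[g _ ->]; exists g. Qed.

Lemma tile_orbit_refl p : tile_orbit p p.
Proof. by exists 1%g; rewrite act1. Qed.

Lemma tile_orbit_step i (g : G i) p q : tg p = i ->
  tile_orbit p q -> tile_orbit p (aU i g q).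
Proof. by move=> pi; case: _ / pi g => g [h ->]; exists (g * h)%g; rewrite actM. Qed.

Definition link := (U * U * nat)%type.
Definition src (l : link) := l.1.1.
Definition dst (l : link) := l.1.2.
Definition len (l : link) := l.2.

(** The length has to be the exact distance between the ends, as the height of the
    glued space must rise by the full length of every link. *)
Definition good_link (l : link) : Prop :=
  [/\ 0 < len l, tile_reach (len l) (src l) (dst l),
      forall k, tile_reach k (src l) (dst l) -> len l <= k &
      forall p q, tile_orbit (src l) p -> tile_orbit (src l) q ->
        tile_reach (K * len l) p q].

(** The point [d] only serves as a default value, as [U] may be empty. *)
Definition nolink (d : U) : link := (d, d, 0).

Definition chain_ok (d : U) (W : seq link) : Prop :=
  (forall j, j < size W -> good_link (nth (nolink d) W j)) /\
  (forall j, j.+1 < size W ->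
     let i := tg (src (nth (nolink d) W j)) in
     let i' := tg (src (nth (nolink d) W j.+1)) in
     i != i' /\ ~~ commuting c i i').

Section Gluing.
Variables (d : U) (W : seq link).
Hypothesis W_ok : chain_ok d W.

Let n := size W.
Let x j := src (nth (nolink d) W j).
Let y j := dst (nth (nolink d) W j).
Let D j := len (nth (nolink d) W j).
Let Z := (nat * U)%type.

Lemma len_gt0 j : j < n -> 0 < D j.
Proof. by move=> /(W_ok.1 j)[]. Qed.

Lemma reach_link j : j < n -> tile_reach (D j) (x j) (y j).
Proof. by move=> /(W_ok.1 j)[]. Qed.

Lemma len_min j k : j < n -> tile_reach k (x j) (y j) -> D j <= k.
Proof. by move=> /(W_ok.1 j)[_ _ + _]; exact. Qed.

Lemma link_diam j p q : j < n -> tile_orbit (x j) p -> tile_orbit (x j) q ->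
  tile_reach (K * D j) p q.
Proof. by move=> /(W_ok.1 j)[_ _ _]; exact. Qed.

Lemma tg_dst j : j < n -> tg (y j) = tg (x j).
Proof. by move=> /reach_link/tile_reach_tg. Qed.

Lemma src_neq_dst j : j < n -> x j != y j.
Proof.
move=> jn; apply/eqP => xy; have := @len_min j 0 jn; rewrite -xy.
by move=> /(_ (tile_reach_refl _ _)); have := len_gt0 jn; lia.
Qed.

Lemma consecutive_tg j : j.+1 < n -> tg (x j) != tg (x j.+1).
Proof. by move=> /(W_ok.2 j)[]. Qed.

Lemma commutingC i j : commuting c i j = commuting c j i.
Proof.
by rewrite /commuting eq_sym; have [//|/c_sym->] := eqVneq j i.
Qed.

Lemma consecutive_noncommuting j :
  j.+1 < n -> ~~ commuting c (tg (x j)) (tg (x j.+1)).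
Proof. by move=> /(W_ok.2 j)[]. Qed.

(** The glued space is carried by [nat * U], a row of copies of [U] in which
    [(j+1, x (j+1))] plays the role of the gluing point, for the tile [j] as well.
    So that [G i] sees the gluing point as the end [(j, y j)] of the tile [j]
    when [i] is the index of that tile, its action on the row is conjugated by
    the involution [swap i] that exchanges these two points.  The leftover points
    [(j, y j)] are then fixed by all vertex groups.  The orbits of the copy [j]
    other than that of the link are carried along unglued. *)
Definition swap (i : I) (z : Z) : Z :=
  if [&& z.1.+1 < n, tg z.2 == i & z.2 == y z.1] then (z.1.+1, x z.1.+1)
  else if [&& 0 < z.1, z.1 < n, tg (y z.1.-1) == i & z.2 == x z.1]
  then (z.1.-1, y z.1.-1) else z.

Lemma swap_dst i j : j.+1 < n -> tg (y j) = i -> swap i (j, y j) = (j.+1, x j.+1).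
Proof. by move=> jn yi; rewrite /swap/= jn yi !eqxx. Qed.

Lemma swap_src i j : j.+1 < n -> tg (y j) = i -> swap i (j.+1, x j.+1) = (j, y j).
Proof.
by move=> jn yi; rewrite /swap/= (negbTE (src_neq_dst jn)) !andbF/= jn yi !eqxx.
Qed.

Lemma swapK i : involutive (swap i).
Proof.
move=> [j p]; rewrite [swap i (j, p)]/swap/=; case: ifP => [|N1].
  by move=> /and3P[jn /eqP pi /eqP py]; rewrite swap_src -?py.
case: ifP => [/and4P[j0 jn /eqP yi /eqP px]|N2]; last by rewrite /swap/= N1 N2.
by have jE := ltn_predK j0; rewrite swap_dst ?jE// -px.
Qed.

Definition naive_act i (g : G i) (z : Z) : Z := (z.1, aU i g z.2).
Definition glued_fun i (g : G i) (z : Z) : Z := swap i (naive_act g (swap i z)).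

Lemma glued_act1 i z : glued_fun (1%g : G i) z = z.
Proof. by rewrite /glued_fun /naive_act act1 -surjective_pairing swapK. Qed.

Lemma glued_actM i (g h : G i) z : glued_fun (g * h)%g z = glued_fun g (glued_fun h z).
Proof. by rewrite /glued_fun swapK /naive_act /= actM. Qed.

Definition glued i : group_action (G i) Z :=
  GroupAction (@glued_act1 i) (@glued_actM i).

(** The map from [U] to the tile [j] of the glued space, equivariant on each
    [X i] under [G i] by [emb_act]. *)
Definition emb (j : nat) (p : U) : Z := swap (tg p) (j, p).

Lemma emb_act i (g : G i) j p : tg p = i -> glued i g (emb j p) = emb j (aU i g p).
Proof. by move=> pi; rewrite /= /glued_fun /emb aU_tg pi swapK. Qed.

(** The union of the tiles of index [i] contains the support of [G i] and is easier
    to handle, since it does not depend on which points are actually moved. *)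
Definition touches (i : I) (z : Z) := exists j p, tg p = i /\ z = emb j p.

Lemma touches_act i (g : G i) z : touches i z -> touches i (glued i g z).
Proof.
move=> [j [p [pi ->]]]; exists j, (aU i g p).
by rewrite aU_tg emb_act.
Qed.

Lemma glued_fix i (g : G i) z : ~ touches i z -> glued i g z = z.
Proof.
move=> zi; rewrite /= /glued_fun /naive_act.
have pi : tg (swap i z).2 != i.
  apply/eqP => pi; apply: zi; exists (swap i z).1, (swap i z).2; split => //.
  by rewrite /emb pi -surjective_pairing swapK.
by rewrite aU_fix// -surjective_pairing swapK.
Qed.

Lemma embE j p : emb j p =
  if (j.+1 < n) && (p == y j) then (j.+1, x j.+1) else (j, p).
Proof.
rewrite /emb /swap/= eqxx /=; case: ifP => // _.
case: ifP => // /and4P[j0 jn /eqP yp /eqP px].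
have jn' : j.-1.+1 < n by rewrite (ltn_predK j0).
have := consecutive_tg jn'; rewrite (ltn_predK j0) -px -yp tg_dst ?eqxx//.
by lia.
Qed.

Lemma emb_glue j : j.+1 < n -> emb j (y j) = emb j.+1 (x j.+1).
Proof.
by move=> jn; rewrite !embE jn eqxx (negbTE (src_neq_dst jn)) andbF.
Qed.

Lemma emb_eq j p k q : emb j p = emb k q ->
  [\/ j = k /\ p = q,
      [/\ j.+1 < n, k = j.+1, p = y j & q = x k] |
      [/\ k.+1 < n, j = k.+1, q = y k & p = x j]].
Proof.
rewrite !embE; case: ifP => [/andP[jn /eqP py]|jN]; case: ifP => [/andP[kn /eqP qy]|kN].
- by move=> [jk _]; constructor 1; split; [lia|rewrite py qy; congr (y _); lia].
- by move=> [jk qx]; constructor 2; split; rewrite -?jk.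
- by move=> [jk qx]; constructor 3; split; rewrite ?jk.
- by move=> [-> ->]; constructor 1.
Qed.

(** A point touched by two vertex groups is a gluing point, and consecutive tiles
    have non-commuting indices. *)
Lemma touches_commuting i j z : touches i z -> touches j z -> ~~ commuting c i j.
Proof.
move=> [k [p [pi ->]]] [k' [q [qj]]] /emb_eq[[_ pq]|[kn k'E py qx]|[kn kE qy px]].
- by rewrite -pi -qj pq /commuting eqxx.
- rewrite -pi -qj py qx tg_dst; last by lia.
  by rewrite k'E; exact: consecutive_noncommuting.
- rewrite -pi -qj qy px tg_dst; last by lia.
  by rewrite kE commutingC; exact: consecutive_noncommuting.
Qed.

Lemma glued_comm i j (g : G i) (h : G j) z : i != j -> c i j ->
  glued i g (glued j h z) = glued j h (glued i g z).
Proof.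
move=> ij cij; have cc : commuting c i j by apply/andP.
have sep z' : touches i z' -> ~ touches j z'.
  by move=> zi zj; have := touches_commuting zi zj; rewrite cc.
have [zi|zi] := pselect (touches i z).
  by rewrite (glued_fix h (sep _ zi)) (glued_fix h (sep _ (touches_act g zi))).
rewrite (glued_fix g zi); have [zj|zj] := pselect (touches j z).
  by rewrite glued_fix// => /sep; apply; exact: touches_act.
by rewrite (glued_fix h zj) glued_fix.
Qed.

(** Height at which the tile [j] starts. *)
Definition pos (j : nat) := \sum_(0 <= k < j) D k.

(** The distance from [p] to [q] truncated at [m], counted as the number of radii
    below [m] at which the ball around [p] misses [q]. *)
Definition tdist (m : nat) (p q : U) : nat :=
  \sum_(0 <= k < m) ~~ `[< tile_reach k p q >].

(** The distance to the first point of the chain, truncated in each tile at the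
    length of its link.  Truncation makes it well defined at the gluing points and
    keeps the tile [j] between [pos j] and [pos (j+1)]. *)
Definition height (z : Z) : nat := pos z.1 + tdist (D z.1) (x z.1) z.2.

Lemma posS j : pos j.+1 = pos j + D j.
Proof. by rewrite /pos big_nat_recr. Qed.

Lemma pos_homo : {homo pos : j k / j <= k}.
Proof.
by apply: homo_leq => [//|? ? ?|j]; [exact: leq_trans|rewrite posS leq_addr].
Qed.

Lemma tdist_refl m p : tdist m p p = 0.
Proof.
rewrite /tdist big1// => k _.
by rewrite asboolT//; exact: tile_reach_refl.
Qed.

Lemma tdist_le m p q : tdist m p q <= m.
Proof.
rewrite -[X in _ <= X]subn0 -[X in _ <= X]muln1 -sum_nat_const_nat.
by apply: leq_sum => k _; exact: leq_b1.
Qed.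

Lemma tdist_eq m p q : (forall k, tile_reach k p q -> m <= k) -> tdist m p q = m.
Proof.
move=> pq; rewrite /tdist (@eq_big_nat _ _ _ _ _ _ (fun=> 1)).
  by rewrite sum_nat_const_nat subn0 muln1.
by move=> k /andP[_ km]; rewrite asboolF// => /pq; lia.
Qed.

Lemma tdist_step m i (s : G i) p q : S i s -> tg p = i \/ aU i s q = q ->
  tdist m p (aU i s q) <= (tdist m p q).+1.
Proof.
move=> Ss [pi|->]; last exact: leqnSn.
case: m => [|m]; first by rewrite /tdist big_geq.
rewrite /tdist big_nat_recl// -add1n; apply: leq_add; first exact: leq_b1.
rewrite [X in _ <= X]big_nat_recr//=; apply: leq_trans (leq_addr _ _).
apply: leq_sum => k _; case: asboolP => // nk; rewrite asboolF// => kq; apply: nk.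
exact: tile_reach_step.
Qed.

Lemma height_emb j p : height (emb j p) = pos j + tdist (D j) (x j) p.
Proof.
rewrite embE; case: ifP => // /andP[jn /eqP ->].
rewrite /height/= posS tdist_refl addn0 tdist_eq// => k.
by apply: len_min; lia.
Qed.

Lemma height_step i (s : G i) z : S i s -> height (glued i s z) <= (height z).+1.
Proof.
move=> Ss; have [[j [p [pi ->]]]|zi] := pselect (touches i z); last first.
  by rewrite glued_fix.
rewrite emb_act// !height_emb -addnS leq_add2l.
have [xi|xi] := eqVneq (tg (x j)) i; first by apply: tdist_step => //; left.
rewrite !tdist_eq// => k /tile_reach_tg.
  by rewrite pi => E; rewrite E eqxx in xi.
by rewrite aU_tg pi => E; rewrite E eqxx in xi.
Qed.

Variable A : group_action (graph_product G c) Z.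
Hypothesis AE : forall i (g : G i) z, A (gp_in c g) z = glued i g z.

Local Notation T := (@gp_gens I G c S).
Local Notation zreach := (reach T A).

Lemma zreach_emb m j p q : tile_reach m p q -> zreach m (emb j p) (emb j q).
Proof.
move=> [w [wm wS] ->]; apply: reach_mono wm _.
elim: w wS => [|s w IHw] wS /=; first exact: reach_refl.
have {}IHw := IHw (fun t tw => wS t (mem_behead (s := s :: w) tw)).
have wtg : tg (foldr (aU (tg p)) p w) = tg p by elim: (w) => //= t v IHv; rewrite aU_tg.
rewrite -emb_act//; rewrite -AE; apply: reach_step IHw.
by exists (tg p), s; split=> //; apply: wS; rewrite mem_head.
Qed.

Lemma gens_sym s : T s -> T s^-1%g.
Proof.
move=> [i [g [Sg ->]]]; exists i, g^-1%g; rewrite gp_inV; split=> //.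
by have [SV _] := S_gen i; exact: SV.
Qed.

Lemma height_lip m z z' : zreach m z z' -> height z' <= height z + m.
Proof.
move=> [w [wm wS] ->]; apply: (@leq_trans (height z + size w)); last first.
  by rewrite leq_add2l.
elim: w wS {wm} => [|s w IHw] wS /=; first by rewrite addn0.
have [|i [g [Sg sE]]] := wS s; first by rewrite mem_head.
rewrite sE AE addnS; apply: leq_trans (height_step _ Sg) _; rewrite ltnS.
by apply: IHw => t tw; apply: wS; rewrite inE tw orbT.
Qed.

Lemma tile_orbit_trans p q r : tile_orbit p q -> tile_orbit q r -> tile_orbit p r.
Proof.
by move=> [g ->] [h ->]; apply: tile_orbit_step; [rewrite aU_tg|exists g].
Qed.

(** Away from the tile of its starting point, a path has entered a tile through one of
    its two gluing points, hence stays close to one of them. *)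
Lemma zreach_cases m j0 p0 z : zreach m (emb j0 p0) z ->
  (exists j p, z = emb j p) /\
  forall j p, z = emb j p -> (j = j0 /\ tile_reach m p0 p) \/
    (j < n /\ (tile_reach m (x j) p \/ tile_reach m (y j) p)).
Proof.
move=> [w [wm wS] ->].
suff [zex zP] : (exists j p, foldr A (emb j0 p0) w = emb j p) /\
  forall j p, foldr A (emb j0 p0) w = emb j p ->
    (j = j0 /\ tile_reach (size w) p0 p) \/
    (j < n /\ (tile_reach (size w) (x j) p \/ tile_reach (size w) (y j) p)).
  split=> // j p /zP[[-> H]|[jn [H|H]]].
  - by left; split=> //; apply: tile_reach_mono wm H.
  - by right; split=> //; left; apply: tile_reach_mono wm H.
  - by right; split=> //; right; apply: tile_reach_mono wm H.
elim: w wS {wm} => [|s w IHw] wS /=.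
  split; first by exists j0, p0.
  move=> j p /emb_eq[[-> ->]|[jn jE _ ->]|[jn jE -> _]].
  - by left; split=> //; exact: tile_reach_refl.
  - by right; split; [lia|left; exact: tile_reach_refl].
  - by right; split; [lia|right; exact: tile_reach_refl].
have [|i [g [Sg sE]]] := wS s; first by rewrite mem_head.
have {IHw}[|[j1 [p1 zE]] zP] := IHw.
  by move=> t tw; apply: wS; rewrite inE tw orbT.
rewrite sE AE; set z' := foldr _ _ _ in zE zP *.
have [[k [q [qi z'E]]]|z'i] := pselect (touches i z'); last first.
  rewrite glued_fix//; split; first by exists j1, p1.
  move=> j p /zP[[-> H]|[jn [H|H]]].
  - by left; split=> //; apply: tile_reach_mono (leqnSn _) H.
  - by right; split=> //; left; apply: tile_reach_mono (leqnSn _) H.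
  - by right; split=> //; right; apply: tile_reach_mono (leqnSn _) H.
rewrite z'E emb_act//; split; first by eexists _, _.
move=> j p /emb_eq[[<- <-]|[kn -> _ ->]|[jn kE -> _]].
- have [[-> H]|[kn [H|H]]] := zP _ _ z'E.
  + by left; split=> //; apply: tile_reach_step => //; rewrite -(tile_reach_tg H).
  + by right; split=> //; left; apply: tile_reach_step => //; rewrite -(tile_reach_tg H).
  + by right; split=> //; right; apply: tile_reach_step => //; rewrite -(tile_reach_tg H).
- by right; split; [lia|left; exact: tile_reach_refl].
- by right; split; [lia|right; exact: tile_reach_refl].
Qed.

Lemma zreach_untouched m z z' : (forall i, ~ touches i z) -> zreach m z z' -> z' = z.
Proof.
move=> zN [w [_ wS] ->]; elim: w wS => [//|s w IHw] wS /=.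
rewrite IHw; last by move=> t tw; apply: wS; rewrite inE tw orbT.
by have [|i [g [_ ->]]] := wS s; [rewrite mem_head|rewrite AE glued_fix].
Qed.

Lemma touches_or z : (exists j p, z = emb j p) \/ forall i, ~ touches i z.
Proof.
have [[i [j [p [_ ->]]]]|zN] := pselect (exists i, touches i z).
  by left; exists j, p.
by right=> i zi; apply: zN; exists i.
Qed.

Lemma tile_reach_link_orbit m j p : j < n ->
  tile_reach m (x j) p \/ tile_reach m (y j) p -> tile_orbit (x j) p.
Proof.
move=> jn [/tile_reach_orbit//|/tile_reach_orbit]; apply: tile_orbit_trans.
exact: tile_reach_orbit (reach_link jn).
Qed.

Lemma glued_orbit_finite (orb : U -> seq U) :
  (forall p q, tile_orbit p q -> q \in orb p) ->
  forall z, exists s : seq Z, forall m z', zreach m z z' -> z' \in s.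
Proof.
move=> orbP z; have [[j0 [p0 ->]]|zN] := touches_or z; last first.
  by exists [:: z] => m z' /(zreach_untouched zN)->; rewrite mem_head.
exists ([seq emb j0 p | p <- orb p0] ++
        flatten [seq [seq emb j p | p <- orb (x j)] | j <- iota 0 n]) => m z'.
move=> /zreach_cases[[j [p z'E]] /(_ _ _ z'E)]; rewrite z'E mem_cat.
move=> [[-> /tile_reach_orbit p0p]|[jn /(tile_reach_link_orbit jn) xp]].
  by rewrite map_f//; exact: orbP.
apply/orP; right; apply/flatten_mapP; exists j; first by rewrite mem_iota.
by apply: map_f; exact: orbP.
Qed.

Lemma zreach_src j : 0 < n -> j < n -> zreach (K * pos j) (emb 0 (x 0)) (emb j (x j)).
Proof.
move=> n0; elim: j => [|j IHj] jn; first exact: reach_refl.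
rewrite posS mulnDr addnC -emb_glue//; apply: reach_trans (IHj _) _; first lia.
apply: zreach_emb; apply: link_diam; [lia|exact: tile_orbit_refl|].
by apply: tile_reach_orbit; apply: reach_link; lia.
Qed.

(** Every point of the orbit of the first point is reached by crossing the previous
    tiles, at a cost of [K] times their length. *)
Lemma zreach_orbit m z : 0 < n -> zreach m (emb 0 (x 0)) z ->
  zreach (K * pos n) (emb 0 (x 0)) z.
Proof.
move=> n0 /zreach_cases[[j [p zE]] /(_ _ _ zE) H]; rewrite zE.
have [jn xp] : j < n /\ tile_orbit (x j) p.
  by case: H => [[-> /tile_reach_orbit H]|[jn /(tile_reach_link_orbit jn) H]].
apply: (@reach_mono _ _ _ _ (K * pos j.+1)).
  by rewrite leq_mul2l pos_homo ?orbT.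
rewrite posS mulnDr addnC; apply: reach_trans (zreach_src n0 jn) _.
by apply: zreach_emb; apply: link_diam => //; exact: tile_orbit_refl.
Qed.

(** The displacement is at least [pos n], by the height, and the diameter at most
    [2 * K * pos n], going through the first point. *)
Lemma glued_controlled g : 0 < n -> symmetric_generating T ->
  A g (emb 0 (x 0)) = emb n.-1 (y n.-1) ->
  A g (emb 0 (x 0)) <> emb 0 (x 0) /\
  forall m, zreach m (emb 0 (x 0)) (A g (emb 0 (x 0))) ->
  forall g1 g2, zreach (K.*2 * m) (A g1 (emb 0 (x 0))) (A g2 (emb 0 (x 0))).
Proof.
move=> n0 Tgen gE; set z0 := emb 0 (x 0).
have h0 : height z0 = 0 by rewrite height_emb /pos big_geq// tdist_refl.
have hn : height (emb n.-1 (y n.-1)) = pos n.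
  rewrite height_emb tdist_eq; first by rewrite -posS prednK.
  by move=> k; apply: len_min; rewrite ltn_predL.
have posn : 0 < pos n.
  apply: (leq_trans _ (pos_homo n0)).
  by rewrite posS; have := len_gt0 n0; lia.
split=> [E|m]; first by move: hn posn; rewrite -gE E h0; lia.
move=> /height_lip; rewrite gE hn h0 add0n => nm g1 g2.
have reachK g' : zreach (K * pos n) z0 (A g' z0).
  by have [k gk] := reach_act A g' z0 Tgen; exact: zreach_orbit gk.
apply: (@reach_mono _ _ _ _ (K * pos n + K * pos n)).
  by rewrite -mulnDr addnn -doubleMr -doubleMl leq_double leq_mul2l nm orbT.
exact: reach_trans (reach_sym gens_sym (reachK g1)) (reachK g2).
Qed.

(** * Balls in the glued action *)

(** Both counts of tiles below compare an indicator, or a length, with the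
    increments of a monotone function along the heights [pos j], which
    telescope. *)
Lemma sum_increments (h : nat -> nat) (m : nat) : {homo h : s t / s <= t} ->
  \sum_(0 <= j < m) (h (pos j.+1) - h (pos j)) <= h (pos m).
Proof.
move=> hh; rewrite (@telescope_sumn_in 0 m (h \o pos))//=; first lia.
by move=> j _; apply/hh/pos_homo.
Qed.

Definition inside (a b j : nat) : bool := (a <= pos j) && (pos j.+1 <= b).
Definition straddles (a j : nat) : bool := (pos j < a) && (a <= pos j.+1).

Lemma sum_inside a b m : \sum_(0 <= j < m) inside a b j * D j <= b - a.
Proof.
(* [h] clamps a height to the window, whose total width bounds the sum. *)
pose h t := minn (maxn t a) b - a.
have hh : {homo h : s t / s <= t} by move=> s t; rewrite /h; lia.
apply: (@leq_trans (h (pos m))); last by rewrite /h; lia.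
apply: leq_trans (sum_increments m hh); apply: leq_sum => j _.
by rewrite /inside /h posS; case: andP => [[]|_]; rewrite ?mul0n//= mul1n; lia.
Qed.

Lemma sum_straddles a m : \sum_(0 <= j < m) straddles a j <= 1.
Proof.
pose h t : nat := a <= t.
have hh : {homo h : s t / s <= t} by move=> s t; rewrite /h; lia.
apply: (@leq_trans (h (pos m))); last exact: leq_b1.
apply: leq_trans (sum_increments m hh).
by apply: leq_sum => j _; rewrite /straddles /h; lia.
Qed.

(** A tile that meets the window of heights within [m] of [h] lies inside it or
    contains one of its ends. *)
Lemma straddlesP h m j t : pos j + t <= h + m -> h <= pos j + t + m ->
  t <= D j -> ~~ inside (h - m) (h + m) j ->
  straddles (h - m) j || straddles (h + m).+1 j.
Proof. by rewrite /inside /straddles negb_and posS; lia. Qed.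

Lemma window_le h m : (h + m) - (h - m) <= 2 * m.
Proof. lia. Qed.

Variables (R : realType) (f : R -> R) (C C1 : R).
Hypotheses (C_gt0 : (0 < C)%R) (C1_gt0 : (0 < C1)%R).
Hypothesis f_ge0 : forall t : R, (0 <= t)%R -> (0 <= f t)%R.
Hypothesis f_incr : forall s t : R, (0 <= s)%R -> (s <= t)%R -> (f s <= f t)%R.
Hypothesis f_sum : forall (k : nat), (1 <= k)%N ->
     forall rho : 'I_k -> R, (forall i, (0 <= rho i)%R) ->
       (\sum_(i < k) f (rho i) <= C1 * f (C1 * \sum_(i < k) rho i))%R.
Hypothesis K_gt0 : 0 < K.
Hypothesis tile_vol : forall m p, 0 < m -> exists2 s : seq U,
  ((size s)%:R <= C * f (C * m%:R))%R & forall q, tile_reach m p q -> q \in s.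

Definition glued_vol_const : R := (5 * C + C * C1 + 2 * C1 * C * K%:R)%R.

(** However many full tiles there are, their total length is at most the width of
    the window, so the assumption on sums of values of [f] applies to them. *)
Lemma sum_f_inside a b : (\sum_(0 <= j < n) (inside a b j)%:R * f (C * (K * D j)%:R)
  <= C1 * f (C1 * C * K%:R * (b - a)%:R))%R.
Proof.
have [n0|n0] := posnP n.
  by rewrite big_geq ?n0// mulr_ge0 ?f_ge0// ?mulr_ge0// ltW.
apply: (@le_trans _ _ (\sum_(j < n) f (C * (K * (inside a b j * D j))%:R))%R).
  rewrite big_mkord; apply: ler_sum => j _.
  case: inside; rewrite ?mul1r ?mul1n// mul0r f_ge0// mulr_ge0// ltW//.
have rho0 (j : 'I_n) : (0 <= C * (K * (inside a b j * D j))%:R :> R)%R.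
  by rewrite mulr_ge0// ltW.
apply: le_trans (f_sum n0 rho0) _; rewrite ler_pM2l//; apply: f_incr.
  by rewrite mulr_ge0 ?sumr_ge0// ltW.
rewrite -mulr_sumr -natr_sum -big_distrr/= natrM !mulrA ler_pM2l; last first.
  by rewrite !mulr_gt0// ltr0n.
by rewrite ler_nat -(big_mkord xpredT (fun j => inside a b j * D j)) sum_inside.
Qed.

(** In [glued_vol_const], the summand [5 * C] counts five balls of radius [m] in [U]:
    four come from the two gluing points of each of the at most two tiles that
    straddle an end of the window, one from the tile of the center.  The other
    summands come from the full tiles. *)
Lemma ball_cover m z : 0 < m -> exists2 s : seq Z,
  ((size s)%:R <= glued_vol_const * f (glued_vol_const * m%:R))%R &
  forall z', zreach m z z' -> z' \in s.
Proof.
move=> m0; set V := glued_vol_const.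
have C_ge0 := ltW C_gt0; have C1_ge0 := ltW C1_gt0.
have CC1 : (0 <= C * C1)%R by exact: mulr_ge0.
have CK : (0 <= 2 * C1 * C * K%:R)%R by rewrite !mulr_ge0.
have V0 : (0 <= V)%R by rewrite /V /glued_vol_const; lra.
have Vmono t : (0 <= t)%R -> (t <= V)%R -> (f (t * m%:R) <= f (V * m%:R))%R.
  by move=> t0 tV; apply: f_incr; rewrite ?mulr_ge0// ler_wpM2r.
have fC : (f (C * m%:R) <= f (V * m%:R))%R.
  by apply: Vmono => //; rewrite /V /glued_vol_const; lra.
have fK : (f (2 * C1 * C * K%:R * m%:R) <= f (V * m%:R))%R.
  by apply: Vmono => //; rewrite /V /glued_vol_const; lra.
have fV0 : (0 <= f (V * m%:R))%R by rewrite f_ge0// mulr_ge0.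
(* Covering lists of the balls of [U], junk at radius [0]. *)
have cover k p : exists s : seq U, 0 < k -> ((size s)%:R <= C * f (C * k%:R))%R /\
     forall q, tile_reach k p q -> q \in s.
  by have [->|/(tile_vol p)[s sC sP]] := posnP k; [exists [::]|exists s].
have {cover}[cov covP] := choice (fun kp : nat * U => cover kp.1 kp.2).
have covC k p : 0 < k -> ((size (cov (k, p)))%:R <= C * f (C * k%:R))%R.
  by move=> k0; have [] := covP (k, p) k0.
have {}covP k p q : 0 < k -> tile_reach k p q -> q \in cov (k, p).
  by move=> k0; have [_ +] := covP (k, p) k0; exact.
have [[j0 [p0 ->]]|zN] := touches_or z; last first.
  (* A ball of [U] around any point shows that the bound is at least [1]. *)
  exists [:: z] => [|z' /(zreach_untouched zN)->]; last by rewrite mem_head.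
  apply: (@le_trans _ _ (size (cov (m, z.2)))%:R%R).
    rewrite ler_nat lt0n size_eq0; apply/eqP => cE.
    by have := covP m z.2 z.2 m0 (tile_reach_refl _ _); rewrite cE.
  apply: le_trans (covC m z.2 m0) _; apply: ler_pM => //.
    by rewrite f_ge0// mulr_ge0.
  by rewrite /V /glued_vol_const; lra.
set h := height (emb j0 p0); set a := h - m; set b := h + m.
pose piece j := if inside a b j then [seq emb j p | p <- cov (K * D j, x j)]
  else if straddles a j || straddles b.+1 j
  then [seq emb j p | p <- cov (m, x j) ++ cov (m, y j)] else [::].
exists ([seq emb j0 p | p <- cov (m, p0)] ++
        flatten [seq piece j | j <- index_iota 0 n]); last first.
  move=> z' zz'; have [[j [p z'E]] /(_ _ _ z'E)H] := zreach_cases zz'.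
  rewrite z'E mem_cat; case: H => [[-> p0p]|[jn xyp]].
    by rewrite map_f// covP.
  apply/orP; right; apply/flatten_mapP; exists j; first by rewrite mem_index_iota.
  have lo := height_lip zz'; have hi := height_lip (reach_sym gens_sym zz').
  rewrite z'E height_emb -/h in lo hi; rewrite /piece; case: ifP => [_|ins].
    apply/map_f/covP; first by rewrite muln_gt0 K_gt0 len_gt0.
    apply: link_diam => //; first exact: tile_orbit_refl.
    exact: tile_reach_link_orbit xyp.
  have -> : straddles a j || straddles b.+1 j.
    exact: straddlesP lo hi (tdist_le _ _ _) (negbT ins).
  by apply: map_f; rewrite mem_cat; case: xyp => H; rewrite (covP _ _ _ m0 H) ?orbT.
have B0 : (0 <= C * f (C * m%:R))%R by rewrite mulr_ge0// f_ge0// mulr_ge0.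
have B20 : (0 <= 2 * (C * f (C * m%:R)))%R by lra.
have pieceC j : j < n -> ((size (piece j))%:R <=
    C * ((inside a b j)%:R * f (C * (K * D j)%:R)) +
    (straddles a j + straddles b.+1 j)%:R * (2 * (C * f (C * m%:R))))%R.
  move=> jn; rewrite /piece; case: inside.
    rewrite size_map mul1r; apply: (le_trans (covC _ _ _)).
      by rewrite muln_gt0 K_gt0 len_gt0.
    by rewrite lerDl mulr_ge0.
  rewrite mul0r mulr0 add0r; case: ifP => [st|_]; last by rewrite mulr_ge0.
  rewrite size_map size_cat; apply: (@le_trans _ _ (2 * (C * f (C * m%:R)))%R).
    by rewrite natrD; have := covC m (x j) m0; have := covC m (y j) m0; lra.
  rewrite -[leLHS]mul1r ler_wpM2r// ler1n.
  by move: st; do 2!case: straddles.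
rewrite size_cat natrD size_map size_flatten sumnE /shape !big_map.
rewrite natr_sum; apply: (@le_trans _ _ (C * f (C * m%:R) +
   (C * (C1 * f (C1 * C * K%:R * (b - a)%:R)) + 2 * (2 * (C * f (C * m%:R)))))%R).
  apply: lerD; first exact: covC.
  apply: (@le_trans _ _ (\sum_(0 <= j < n)
      (C * ((inside a b j)%:R * f (C * (K * D j)%:R)) +
      (straddles a j + straddles b.+1 j)%:R * (2 * (C * f (C * m%:R)))))%R).
    by apply: ler_sum_nat => j /andP[_ jn]; exact: pieceC.
  rewrite big_split/= -mulr_sumr -mulr_suml; apply: lerD.
    by rewrite ler_pM2l//; exact: sum_f_inside.
  rewrite ler_wpM2r// -natr_sum ler_nat big_split/=.
  exact: leq_add (sum_straddles a n) (sum_straddles b.+1 n).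
have fba : (f (C1 * C * K%:R * (b - a)%:R) <= f (V * m%:R))%R.
  apply: le_trans fK; apply: f_incr; first by rewrite !mulr_ge0.
  have -> : (2 * C1 * C * K%:R * m%:R = C1 * C * K%:R * (2 * m)%:R :> R)%R.
    by rewrite natrM; ring.
  by rewrite ler_wpM2l ?mulr_ge0// ler_nat window_le.
have := ler_wpM2l CC1 fba; have := ler_wpM2l C_ge0 fC.
have := mulr_ge0 CK fV0; rewrite /V /glued_vol_const.
lra.
Qed.

Lemma touches_dst j i : j < n -> touches i (emb j (y j)) ->
  i = tg (x j) \/ j.+1 < n /\ i = tg (x j.+1).
Proof.
move=> jn [k [p [<-]]] /emb_eq[[_ <-]|[jn' -> _ ->]|[_ jE _ yx]].
- by left; exact: tg_dst.
- by right.
- by have := src_neq_dst jn; rewrite -yx eqxx.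
Qed.

End Gluing.

Hypothesis controlled : forall i (g : G i), g <> 1%g -> exists p,
  [/\ tg p = i, aU i g p <> p & forall m, tile_reach m p (aU i g p) ->
    forall q r, tile_orbit p q -> tile_orbit p r -> tile_reach (K * m) q r].

Lemma link_exists i (g : G i) : g <> 1%g -> exists l,
  [/\ good_link l, tg (src l) = i & dst l = aU i g (src l)].
Proof.
move=> /controlled[p [pi gp gK]].
have ex : exists m, `[< tile_reach m p (aU i g p) >].
  case: _ / pi g {gp gK} => g.
  by have [m gm] := reach_act (aU (tg p)) g p (S_gen (tg p)); exists m; apply/asboolP.
case: (ex_minnP ex) => m /asboolP mP mmin.
exists (p, aU i g p, m); split=> //; split=> //=.
- by rewrite lt0n; apply/eqP => m0; apply: gp; rewrite m0 in mP; exact: reach0 mP.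
- by move=> k kP; apply: mmin; apply/asboolP.
- by move=> q r; exact: gK.
Qed.

Lemma word_act_fix Z (a : forall i, group_action (G i) Z) (l : fp_word G) z :
  (forall s, s \in l -> a (tag s) (tagged s) z = z) -> word_act a l z = z.
Proof.
elim: l => [//|s l IHl] lz /=; rewrite IHl; first by rewrite lz ?mem_head.
by move=> t tl; rewrite lz// inE tl orbT.
Qed.

Lemma chain_ok_cons d l0 l1 w : good_link l0 -> chain_ok d (l1 :: w) ->
  tg (src l0) != tg (src l1) -> ~~ commuting c (tg (src l0)) (tg (src l1)) ->
  chain_ok d (l0 :: l1 :: w).
Proof.
by move=> gl [ok1 ok2] tt nc; split=> [[|j]|[|j]] //=; [exact: ok1|exact: ok2].
Qed.

(** The chain starts with a link for the syllable that acts first and continues with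
    the chain of the next kept syllable.  The conclusion is stated inside any chain
    [W] that ends with the constructed one, because prepending a link changes the
    action at the first point of the chain. *)
Lemma greedy_chain t l : reduced c (t :: l) -> exists l0 w,
  [/\ tg (src l0) = tag t, forall d, chain_ok d (l0 :: w) &
   forall d W (ok : chain_ok d W) j, drop j W = l0 :: w ->
     word_act (glued ok) (rev (t :: l)) (emb d W j (src l0)) =
     emb d W (size W).-1 (dst (nth (nolink d) W (size W).-1))].
Proof.
have [k] := ubnP (size l); elim: k t l => // k IHk t l lk red.
have t1 : tagged t <> 1%g by have [r1 _] := red; exact: (r1 [::] t l).
have [l0 [gl0 l0t l0E]] := link_exists t1.
have start d W (ok : chain_ok d W) j w : drop j W = l0 :: w ->
  [/\ j < size W, size W = (j + size w).+1, nth (nolink d) W j = l0, drop j.+1 W = w &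
    forall u, word_act (glued ok) (rev (t :: u)) (emb d W j (src l0)) =
      word_act (glued ok) (rev u) (emb d W j (dst (nth (nolink d) W j)))].
  move=> dW; have jW : j < size W by rewrite -subn_gt0 -size_drop dW.
  have nE : nth (nolink d) W j = l0 by rewrite -[j]addn0 -nth_drop dW.
  split=> //.
  - by have := size_drop j W; rewrite dW/=; lia.
  - by rewrite -add1n -drop_drop dW /= drop0.
  - move=> u; rewrite rev_cons -cats1 word_act_cat nE; congr word_act.
    by rewrite l0E -emb_act.
have [lc|[l1 [t' [l2 [lE l1c tt' ntt']]]]] := reduced_next red.
  exists l0, [::]; split=> // [d|d W ok j dW].
    by split=> [[|j]|[|j]].
  have [jW WE nE _ ->] := start _ _ ok _ _ dW.
  rewrite WE addn0 /=; apply: word_act_fix => s; rewrite mem_rev => /(allP lc).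
  move=> /andP[ts _]; apply: glued_fix => // /(touches_dst ok jW); rewrite nE.
  by rewrite l0t => -[sE|[]]; [rewrite sE eqxx in ts|rewrite WE addn0 ltnn].
have [||l0' [w [l0't ok' E]]] := IHk t' l2.
- by rewrite lE size_cat/= addnS ltnS in lk; exact: leq_ltn_trans (leq_addl _ _) lk.
- by apply: (@reduced_behead _ _ _ (t :: l1)); rewrite /= -lE.
exists l0, (l0' :: w); split=> // [d|d W ok j dW].
  by apply: chain_ok_cons; rewrite ?l0t ?l0't.
have [jW WE nE dW' ->] := start _ _ ok _ _ dW.
rewrite lE rev_cat word_act_cat.
have jW' : j.+1 < size W by rewrite WE /= addnS !ltnS leq_addr.
have nE' : nth (nolink d) W j.+1 = l0' by rewrite -[j.+1]addn0 -nth_drop dW'.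
(* The skipped syllables commute with [t] but [t'] does not, so their indices
   differ from those of the two tiles that meet at the gluing point. *)
have -> : word_act (glued ok) (rev l1) (emb d W j (dst (nth (nolink d) W j))) =
    emb d W j (dst (nth (nolink d) W j)).
  apply: word_act_fix => s; rewrite mem_rev => /(allP l1c) ts.
  apply: glued_fix => // /(touches_dst ok jW); rewrite nE nE' l0t l0't.
  case=> [sE|[_ sE]]; last by move: ntt'; rewrite -sE ts.
  by move: ts; rewrite /commuting sE eqxx.
by rewrite (emb_glue ok)// nE'; exact: E.
Qed.

End Chains.

(** * Generators and unions of actions *)

Section Generators.
Variables (I : finType) (G : I -> groupType) (c : I -> I -> bool).
Variable S : forall i, set (G i).
Arguments S : clear implicits.

Lemma word_ballM (H : groupType) (T : set H) m n g h :
  word_ball T m g -> word_ball T n h -> word_ball T (m + n) (g * h)%g.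
Proof.
move=> [u [um uT ->]] [v [vn vT ->]]; exists (u ++ v); split.
- by rewrite size_cat leq_add.
- by move=> s; rewrite mem_cat => /orP[/uT|/vT].
- by rewrite big_cat.
Qed.

Lemma gp_gens_finite : (forall i, finite_set (S i)) -> finite_set (@gp_gens I G c S).
Proof.
move=> Sfin.
have -> : @gp_gens I G c S = \bigcup_(i in [set: I]) (@gp_in I G c i @` S i).
  apply/seteqP; split=> [_ [i [s [Ss ->]]]|_ [i _ [s Ss <-]]].
    by exists i => //; exists s.
  by exists i, s.
by apply: bigcup_finite => // i _; exact: finite_image.
Qed.

Lemma gp_gens_generating : (forall i, symmetric_generating (S i)) ->
  symmetric_generating (@gp_gens I G c S).
Proof.
move=> S_gen; split=> [s|g]; first exact: gens_sym.
have [l <-] := syllables_prodP g; elim: l => [|[i h] l [n ln]] /=.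
  by exists 0, [::]; rewrite big_nil.
have [_ /(_ h)[m [w [wm wS hE]]]] := S_gen i.
exists (m + n); apply: word_ballM => //.
exists [seq gp_in c s | s <- w]; split; first by rewrite size_map.
  by move=> _ /mapP[s /wS Ss ->]; exists i, s.
rewrite {}hE big_map /=; elim: w {wm wS} => [|s w IHw].
  by rewrite !big_nil gp_in1.
by rewrite !big_cons gp_inM IHw.
Qed.

End Generators.

Section SumAction.
Variables (I : choiceType) (G : I -> groupType) (X : I -> choiceType).
Variable a : forall i, group_action (G i) (X i).
Local Notation U := {i : I & X i}.

(** With all vertex groups acting on one carrier, the links of a chain are made of
    points of a single type. *)
Definition sum_fun i (g : G i) (u : U) : U :=
  if tag u =P i is ReflectT e then Tagged X (a i g (etagged e)) else u.

Lemma sum_funE i (g : G i) p : sum_fun g (Tagged X p) = Tagged X (a i g p).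
Proof. by rewrite /sum_fun; case: eqP => //= e; rewrite (eq_axiomK e). Qed.

Lemma sum_fun_fix i (g : G i) u : tag u != i -> sum_fun g u = u.
Proof. by rewrite /sum_fun; case: eqP. Qed.

Lemma sum_fun1 i u : sum_fun (1%g : G i) u = u.
Proof.
have [ui|ui] := eqVneq (tag u) i; last exact: sum_fun_fix.
by case: _ / ui; case: u => j p; rewrite sum_funE act1.
Qed.

Lemma sum_funM i (g h : G i) u : sum_fun (g * h)%g u = sum_fun g (sum_fun h u).
Proof.
have [ui|ui] := eqVneq (tag u) i; last by rewrite !sum_fun_fix.
by case: _ / ui g h; case: u => j p g h; rewrite !sum_funE actM.
Qed.

Definition sum_act i : group_action (G i) U :=
  GroupAction (@sum_fun1 i) (@sum_funM i).

Lemma sum_act_tag i (g : G i) u : tag (sum_act i g u) = tag u.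
Proof.
have [ui|ui] := eqVneq (tag u) i; last by rewrite /= sum_fun_fix.
by case: _ / ui g; case: u => j p g; rewrite /= sum_funE.
Qed.

Lemma sum_act_word i (w : seq (G i)) p :
  foldr (sum_act i) (Tagged X p) w = Tagged X (foldr (a i) p w).
Proof. by elim: w => //= g w ->; rewrite sum_funE. Qed.

Lemma reach_sum i (S : set (G i)) n p q : reach S (a i) n p q ->
  reach S (sum_act i) n (Tagged X p) (Tagged X q).
Proof. by move=> [w wP ->]; exists w; rewrite ?sum_act_word. Qed.

Lemma sum_reach i (S : set (G i)) n p u : reach S (sum_act i) n (Tagged X p) u ->
  exists2 q, u = Tagged X q & reach S (a i) n p q.
Proof.
move=> [w wP ->]; exists (foldr (a i) p w); first by rewrite sum_act_word.
by exists w.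
Qed.

End SumAction.

Section FamilyAction.
Variables (H : groupType) (L Z : Type) (b : L -> group_action H Z).

Definition family_fun (g : H) (z : L * Z) : L * Z := (z.1, b z.1 g z.2).

Lemma family_fun1 z : family_fun 1%g z = z.
Proof. by case: z => k z; rewrite /family_fun act1. Qed.

Lemma family_funM g h z : family_fun (g * h)%g z = family_fun g (family_fun h z).
Proof. by rewrite /family_fun actM. Qed.

Definition family_act : group_action H {classic L * Z} :=
  GroupAction family_fun1 family_funM.

Lemma family_act_word (w : seq H) k z :
  foldr family_act (k, z) w = (k, foldr (b k) z w).
Proof. by elim: w => //= g w ->. Qed.

Lemma reach_family (T : set H) n k z z' : reach T (b k) n z z' ->
  reach T family_act n (k, z) (k, z').
Proof. by move=> [w wP ->]; exists w; rewrite ?family_act_word. Qed.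

Lemma family_reach (T : set H) n k z u : reach T family_act n (k, z) u ->
  u.1 = k /\ reach T (b k) n z u.2.
Proof. by move=> [w wP ->]; rewrite family_act_word; split=> //; exists w. Qed.

End FamilyAction.

(** * Closure under graph products *)

(** Finiteness of [I] allows common constants. *)
Lemma uniform_CD_data (R : realType) (f : R -> R) (I : finType) (G : I -> groupType) :
  (forall x : R, (0 <= x)%R -> (0 <= f x)%R) ->
  (forall x y : R, (0 <= x)%R -> (x <= y)%R -> (f x <= f y)%R) ->
  (forall i, class_CD f (G i)) ->
  exists (S : forall i, set (G i)) (X : I -> choiceType)
    (a : forall i, group_action (G i) (X i)) (K : nat) (C : R),
    [/\ 0 < K, (0 < C)%R & forall i, CD_data f (S i) (a i) K C].
Proof.
move=> f_ge0 f_incr G_CD.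
have D i : {S : set (G i) & {X : choiceType & {a : group_action (G i) X &
    {K : nat & {C : R | (0 < C)%R /\ CD_data f S a K C}}}}}.
  have /cid[S /cid[X /cid[a /cid[K /cid CP]]]] := class_CD_data (G_CD i).
  by exists S, X, a, K.
pose Ki i := projT1 (projT2 (projT2 (projT2 (D i)))).
pose Ci i := sval (projT2 (projT2 (projT2 (projT2 (D i))))).
have Ci_gt0 i : (0 < Ci i)%R.
  by rewrite /Ci; case: (projT2 (projT2 (projT2 (projT2 (D i))))) => C [].
exists (fun i => projT1 (D i)), (fun i => projT1 (projT2 (D i))),
  (fun i => projT1 (projT2 (projT2 (D i)))), (\sum_i Ki i).+1, (1 + \sum_i Ci i)%R.
have sC i : (Ci i <= \sum_j Ci j)%R.
  by rewrite (bigD1 i)//= lerDl sumr_ge0// => j _; exact/ltW.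
split=> // [|i].
  by rewrite ltr_pwDl// sumr_ge0// => j _; exact/ltW.
have := proj2 (svalP (projT2 (projT2 (projT2 (projT2 (D i)))))).
rewrite -/(Ci i) -/(Ki i) => -[Sfin Sgen orb dia volu]; split=> //.
  move=> g /dia[x gx xP]; exists x => // m xm g1 g2.
  apply: reach_mono (xP _ xm g1 g2); rewrite leq_mul2r; apply/orP; right.
  by rewrite (bigD1 i)//= -addnS leq_addr.
move=> m x m0; have [s sC' sP] := volu m x m0; exists s => //.
apply: le_trans sC' _.
have CC : (Ci i <= 1 + \sum_j Ci j)%R.
  by apply: le_trans (sC i) _; rewrite lerDr.
have Ci0 := ltW (Ci_gt0 i).
apply: ler_pM => //; first by rewrite f_ge0// mulr_ge0.
by apply: f_incr; rewrite ?mulr_ge0// ler_wpM2r.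
Qed.

Local Open Scope ring_scope.

Theorem proposition2p13 (R : realType) (f : R -> R)
  (f_ge0 : forall x : R, 0 <= x -> 0 <= f x)
  (f_incr : forall x y : R, 0 <= x -> x <= y -> f x <= f y)
  (f_sum : exists2 C1 : R, 0 < C1 &
     forall (k : nat), (1 <= k)%N ->
     forall rho : 'I_k -> R, (forall i, 0 <= rho i) ->
       \sum_(i < k) f (rho i) <= C1 * f (C1 * \sum_(i < k) rho i))
  (I : finType) (G : I -> groupType)
  (G_CD : forall i : I, class_CD f (G i))
  (c : I -> I -> bool)
  (c_sym : forall i j : I, i != j -> c i j = c j i) :
  class_CD f (graph_product G c).
Proof.
have [C1 C1_gt0 f_sub] := f_sum.
have [S [X [a [K [C [K_gt0 C_gt0 aP]]]]]] := uniform_CD_data f_ge0 f_incr G_CD.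
pose U : choiceType := {i : I & X i}; pose tg (u : U) := tag u.
pose aU i : group_action (G i) U := sum_act a i.
have aU_fix i (g : G i) p : tg p != i -> aU i g p = p by exact: sum_fun_fix.
have aU_tg i (g : G i) p : tg (aU i g p) = tg p by exact: sum_act_tag.
have S_gen i : symmetric_generating (S i) := cd_gen (aP i).
have aUE i (g : G i) x : aU i g (Tagged X x) = Tagged X (a i g x).
  exact: sum_funE.
have Tagged_inj i : injective (@Tagged I i X) by exact: eq_from_Tagged.
have vol_U m p : (0 < m)%N -> exists2 s : seq U, ((size s)%:R <= C * f (C * m%:R))%R &
    forall q, tile_reach tg aU S m p q -> q \in s.
  case: p => i x m0; have [s sC sP] := cd_vol (aP i) x m0.
  exists [seq Tagged X y | y <- s]; rewrite ?size_map// => q.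
  by move=> /sum_reach[y -> /sP ys]; exact: map_f.
have orb_U p : exists s : seq U, forall q, tile_orbit tg aU p q -> q \in s.
  case: p => i x; have [s sP] := cd_orbit (aP i) x.
  exists [seq Tagged X y | y <- s] => _ [g ->].
  by rewrite aUE; apply: map_f; exact: sP.
have ctrl i (g : G i) : g <> 1%g -> exists p, [/\ tg p = i, aU i g p <> p &
    forall m, tile_reach tg aU S m p (aU i g p) -> forall q r,
      tile_orbit tg aU p q -> tile_orbit tg aU p r ->
      tile_reach tg aU S (K * m)%N q r].
  move=> /(cd_diam (aP i))[x gx xP]; exists (Tagged X x); split=> //.
    by rewrite aUE => /Tagged_inj.
  rewrite aUE => m /sum_reach[_ /Tagged_inj<- /xP xm] _ _ [g1 ->] [g2 ->].
  by rewrite !aUE; exact: reach_sum.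
pose L := {dW : U * seq (link U) | chain_ok c tg aU S K dW.1 dW.2}.
have act_L (k : L) : {A : group_action (graph_product G c) (nat * U) |
    forall i (g : G i) z, A (gp_in c g) z = glued (svalP k) i g z}.
  apply/cid/graph_product_action => i j g h z ij cij.
  exact: glued_comm.
pose A k := sval (act_L k).
have AE k := svalP (act_L k).
pose b := family_act A.
have T_gen := gp_gens_generating c S_gen.
apply: (@CD_data_class R f _ (@gp_gens I G c S) _ b K.*2 (glued_vol_const K C C1)).
  by rewrite /glued_vol_const !addr_gt0// !mulr_gt0// ltr0n.
have [orb orbP] := choice orb_U.
split.
- exact: gp_gens_finite (fun i => cd_fin (aP i)).
- exact: T_gen.
- move=> [k z]; have [s sP] := glued_orbit_finite aU_fix aU_tg (AE k) orbP z.
  exists [seq (k, z') | z' <- s] => g; apply: map_f.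
  by have [m zm] := reach_act (A k) g z T_gen; exact: sP zm.
- move=> g; have [[|t l] red <-] := reduced_word g; first by case.
  move=> _; have [l0 [w [_ ok]]] := greedy_chain aU_fix aU_tg S_gen ctrl red.
  move=> /(_ (src l0) (l0 :: w) (ok _) 0 erefl) E.
  pose k : L := exist _ (src l0, l0 :: w) (ok (src l0)).
  have Aword u z : A k (syllables_prod c u) z = word_act (glued (svalP k)) u z.
    elim: u => [|s u IHu] /=; first exact: act1.
    by rewrite actM IHu AE.
  have [moved ctl] := glued_controlled aU_fix aU_tg S_gen (AE k) isT T_gen
    (etrans (Aword _ _) E).
  exists (k, emb tg (src l0) (l0 :: w) 0 (src l0)); first by case.
  move=> m H g1 g2; have [_ zm] := family_reach H; apply: reach_family.
  exact: ctl zm g1 g2.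
- move=> m [k z] m0.
  have [s sC sP] := ball_cover aU_fix aU_tg S_gen (AE k) C_gt0 C1_gt0 f_ge0 f_incr
    f_sub K_gt0 vol_U z m0.
  exists [seq (k, z') | z' <- s]; first by rewrite size_map.
  move=> [k' z'] H; have [/= -> zz'] := family_reach H; exact/map_f/sP.
Qed.
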